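(* Let $F$ be a field. Rank-stability of a finitely presented $F$-algebra does not depend on its presentation. That is, if $$F\langle x_1,\dots,x_d\rangle/\langle P_1,\dots,P_r\rangle\;\cong\; F\langle y_1,\dots,y_e\rangle/\langle Q_1,\dots,Q_s\rangle$$ as $F$-algebras (two finite presentations of the same algebra), then the first presentation is rank-stable if and only if the second presentation is rank-stable.
   Context: Algebras are associative and unital over a field $F$; $F\langle x_1,\dots,x_d\rangle$ denotes the free associative unital algebra (non-commutative polynomials), and $\langle P_1,\dots,P_r\rangle$ is the two-sided ideal generated by $P_1,\dots,P_r$. For $A\in M_n(F)$ let $\operatorname{rank}(A)=\dim_F\operatorname{Im}A$ and let $\operatorname{rk}(A)=\frac1n\operatorname{rank}(A)$ (normalized rank). For $A\in M_n(F)$, $\widehat{A}$ is the finitely supported $\mathbb{N}\times\mathbb{N}$ matrix that agrees with $A$ in entries $(i,j)$ with $1\le i,j\le n$ and is zero elsewhere. When matrices in $M_n(F)$ are substituted into a non-commutative polynomial, constant terms are interpreted as scalar $n\times n$ matrices. A finite presentation $F\langle x_1,\dots,x_d\rangle/\langle P_1,\dots,P_r\rangle$ is rank-stable if for every $\varepsilon>0$ there exists $\delta>0$ such that for every $n\ge 1$ and every tuple $A_1,\dots,A_d\in M_n(F)$ with $\operatorname{rk}P_i(A_1,\dots,A_d)<\delta$ for all $1\le i\le r$, there exist $n'\ge 1$ and $B_1,\dots,B_d\in M_{n'}(F)$ with $P_i(B_1,\dots,B_d)=0$ for all $1\le i\le r$ and $\operatorname{rank}(\widehat{A_i}-\widehat{B_i})<\varepsilon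 n$ for all $1\le i\le d$. *)

(* Defs.v *)
From HB Require Import structures.
From mathcomp Require Import all_boot all_order all_algebra.
From mathcomp Require Import boolp reals.
From mathcomp Require Import finmap.
From mathcomp.multinomials Require Import monalg.

Set Implicit Arguments.
Unset Strict Implicit.
Unset Printing Implicit Defensive.

Import GRing.Theory Num.Theory.

Local Open Scope ring_scope.
Local Open Scope quotient_scope.

(* F<x_1, ..., x_d>: the monoid algebra over F of the free monoid on d letters *)
Notation "{ 'freealg' F [ d ] }" := {malg F[{fmonom 'I_d}]}
  (at level 0, F, d at level 2, format "{ 'freealg'  F [ d ] }") : type_scope.

(* The value P(A_1, ..., A_d); a constant c is sent to the scalar matrix c%:M,
   and a word i_1 ... i_k to A i_1 * ... * A i_k *)
Definition mxeval (F : fieldType) (d n : nat) (A : 'I_d -> 'M[F]_n.+1)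
    (P : {freealg F[d]}) : 'M[F]_n.+1 :=
  mmap (@scalar_mx F n.+1) (fun w : {fmonom 'I_d} => \prod_(i <- w) A i) P.

Section TwoSidedQuotient.
Variables (F : fieldType) (L : lalgType F) (I : Type) (P : I -> L).

Inductive in_ideal : L -> Prop :=
| in_ideal_gen i : in_ideal (P i)
| in_ideal0 : in_ideal 0
| in_idealD x y : in_ideal x -> in_ideal y -> in_ideal (x + y)
| in_idealMl a x : in_ideal x -> in_ideal (a * x)
| in_idealMr x a : in_ideal x -> in_ideal (x * a).

Definition ideal_pred (x : L) : bool := `[< in_ideal x >].

Lemma ideal_predP x : reflect (in_ideal x) (x \in ideal_pred).
Proof. exact: asboolP. Qed.

Fact ideal_zmod_closed : zmod_closed ideal_pred.
Proof.
split=> [|x y /ideal_predP Ix /ideal_predP Iy]; apply/ideal_predP.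
  exact: in_ideal0.
by apply: in_idealD => //; rewrite -mulN1r; apply: in_idealMl.
Qed.

HB.instance Definition _ :=
  GRing.isZmodClosed.Build L ideal_pred ideal_zmod_closed.

Definition quotalg : Type :=
  ring_quotient.Quotient.quot (GRing.ZmodClosed.clone L ideal_pred _).

HB.instance Definition _ := GRing.Zmodule.on quotalg.
HB.instance Definition _ : EqQuotient L _ quotalg :=
  EqQuotient.on (ring_quotient.Quotient.quot _).
Lemma quotalg_eqP x y : reflect (in_ideal (x - y)) (x == y %[mod quotalg]).
Proof. by rewrite -ring_quotient.Quotient.idealrBE; apply: ideal_predP. Qed.

Lemma in_ideal_repr x : in_ideal (repr (\pi_quotalg x) - x).
Proof. by apply/quotalg_eqP; rewrite reprK. Qed.

Lemma in_idealZ c x : in_ideal x -> in_ideal (c *: x).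
Proof. by rewrite -[x in c *: x]mul1r scalerAl; apply: in_idealMl. Qed.

Definition qone : quotalg := \pi_quotalg 1.
Definition qmul (u v : quotalg) : quotalg := \pi_quotalg (repr u * repr v).
Definition qscale (c : F) (u : quotalg) : quotalg := \pi_quotalg (c *: repr u).

Lemma qmulE x y : qmul (\pi x) (\pi y) = \pi_quotalg (x * y).
Proof.
apply/eqP/quotalg_eqP; set x' := repr _; set y' := repr _.
have -> : x' * y' - x * y = x' * (y' - y) + (x' - x) * y.
  by rewrite mulrBr mulrBl addrA subrK.
by apply: in_idealD; [apply: in_idealMl|apply: in_idealMr];
  apply: in_ideal_repr.
Qed.

Lemma qscaleE c x : qscale c (\pi x) = \pi_quotalg (c *: x).
Proof.
by apply/eqP/quotalg_eqP; rewrite -scalerBr; apply/in_idealZ/in_ideal_repr.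
Qed.

Lemma quotalg_addE x y : \pi_quotalg x + \pi_quotalg y = \pi_quotalg (x + y).
Proof. by apply: esym; apply: ring_quotient.Quotient.pi_add. Qed.

Fact qmulA : associative qmul.
Proof.
by elim/quotW=> x; elim/quotW=> y; elim/quotW=> z; rewrite !qmulE mulrA.
Qed.

Fact qmul1 : left_id qone qmul.
Proof. by elim/quotW=> x; rewrite qmulE mul1r. Qed.

Fact qmulr1 : right_id qone qmul.
Proof. by elim/quotW=> x; rewrite qmulE mulr1. Qed.

Fact qmulDl : left_distributive qmul +%R.
Proof.
elim/quotW=> x; elim/quotW=> y; elim/quotW=> z.
by rewrite quotalg_addE !qmulE mulrDl -quotalg_addE.
Qed.

Fact qmulDr : right_distributive qmul +%R.
Proof.
elim/quotW=> x; elim/quotW=> y; elim/quotW=> z.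
by rewrite quotalg_addE !qmulE mulrDr -quotalg_addE.
Qed.

HB.instance Definition _ := GRing.Zmodule_isPzRing.Build quotalg
  qmulA qmul1 qmulr1 qmulDl qmulDr.

Fact qscaleA a b u : qscale a (qscale b u) = qscale (a * b) u.
Proof. by elim/quotW: u => x; rewrite !qscaleE scalerA. Qed.

Fact qscale1 : left_id 1 qscale.
Proof. by elim/quotW=> x; rewrite qscaleE scale1r. Qed.

Fact qscaleDr : right_distributive qscale +%R.
Proof.
move=> c; elim/quotW=> x; elim/quotW=> y.
by rewrite quotalg_addE !qscaleE scalerDr -quotalg_addE.
Qed.

Fact qscaleDl u : {morph qscale^~ u : a b / a + b}.
Proof. by elim/quotW: u => x a b; rewrite !qscaleE scalerDl -quotalg_addE. Qed.

HB.instance Definition _ := GRing.Zmodule_isLmodule.Build F quotalg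
  qscaleA qscale1 qscaleDr qscaleDl.

Lemma quotalg_mulE x y : \pi_quotalg x * \pi_quotalg y = \pi_quotalg (x * y).
Proof. exact: qmulE. Qed.

Lemma quotalg_scaleE c x : c *: \pi_quotalg x = \pi_quotalg (c *: x).
Proof. exact: qscaleE. Qed.

End TwoSidedQuotient.

(* F<x_1, ..., x_d> / <P_1, ..., P_r>. It may be the zero ring, so it is only a
   pzRingType and an lmodType F: lalgType and algType require 1 != 0. *)
Definition fpalg (F : fieldType) (d r : nat) (P : 'I_r -> {freealg F[d]}) :=
  quotalg P.

HB.instance Definition _ (F : fieldType) d r (P : 'I_r -> {freealg F[d]}) :=
  GRing.PzRing.on (fpalg P).
HB.instance Definition _ (F : fieldType) d r (P : 'I_r -> {freealg F[d]}) :=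
  GRing.Lmodule.on (fpalg P).

Definition fpalg_isom (F : fieldType) (d r e s : nat)
    (P : 'I_r -> {freealg F[d]}) (Q : 'I_s -> {freealg F[e]}) : Prop :=
  exists f : {linear fpalg P -> fpalg Q}, monoid_morphism f /\ bijective f.

Definition nrk (R : realType) (F : fieldType) (n : nat) (A : 'M[F]_n) : R :=
  (\rank A)%:R / n%:R.

Definition hatmx (F : fieldType) (n : nat) (A : 'M[F]_n) (i j : nat) : F :=
  match insub i : option 'I_n, insub j : option 'I_n with
  | Some i', Some j' => A i' j'
  | _, _ => 0
  end.

Definition corner (F : fieldType) (N : nat) (M : nat -> nat -> F) : 'M[F]_N :=
  \matrix_(i < N, j < N) M i j.

(* Any N bounding the support of M gives the same rank of corner N M, namely
   the rank of the infinite matrix M. *)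
Lemma rank_corner (F : fieldType) (N N' : nat) (M : nat -> nat -> F) :
  (forall i j, M i j != 0 -> (i < N)%N && (j < N)%N) -> (N <= N')%N ->
  \rank (corner N' M) = \rank (corner N M).
Proof.
move=> supp /subnKC <-; move: (N' - N)%N => k.
rewrite -[RHS]addn0 -(@mxrank0 F k k) -rank_diag_block_mx; congr mxrank.
have M0 i j : ~~ ((i < N)%N && (j < N)%N) -> M i j = 0.
  by move=> h; apply/eqP; apply: contraNT h; apply: supp.
apply/matrixP => i j; rewrite !mxE.
case: splitP => i' ->; rewrite !mxE; case: splitP => j' ->; rewrite !mxE //;
  by apply: M0; rewrite ?[(N + _ < N)%N]ltnNge ?leq_addr ?andbF.
Qed.

Definition rank_hatB (F : fieldType) (n m : nat) (A : 'M[F]_n) (B : 'M[F]_m) :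
    nat :=
  \rank (corner (maxn n m) (fun i j => hatmx A i j - hatmx B i j)).

Definition rank_stable (R : realType) (F : fieldType) (d r : nat)
    (P : 'I_r -> {freealg F[d]}) : Prop :=
  forall eps : R, 0 < eps -> exists2 delta : R, 0 < delta &
    forall (n : nat) (A : 'I_d -> 'M[F]_n.+1),
      (forall i, nrk R (mxeval A (P i)) < delta) ->
      exists (n' : nat) (B : 'I_d -> 'M[F]_n'.+1),
        (forall i, mxeval B (P i) = 0) /\
        (forall i, (rank_hatB (A i) (B i))%:R < eps * n.+1%:R).

(* Main.v *)
(* Lift the isomorphism and its inverse to tuples G and H of non-commutative
   polynomials. If A almost satisfies Q, then G(A) almost satisfies P, because
   each P_i(G) lies in <Q>; by stability an exact solution B of P is rank-close
   to G(A). Then H(B) solves Q exactly, and H(G(A)) is rank-close to A because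
   each y_j - H_j(G) lies in <Q>.

   H(G(A)) and H(B) are rank-close provided their sizes n and n' are too: a
   constant term c of H contributes |n - n'| to the rank of the difference. The
   sizes need not be close, so B is first replaced. If n' > n, most of the extra
   coordinates span a space killed by all the B_i, and one divides it out. If
   n' < n, either all P_i have constant term 0 and B can be padded by zeros, or
   P_i has constant term c <> 0 and then P_i(A) acts as c on the many extra
   coordinates killed by all the A_j, which forces n - n' to be small since
   P_i(A) has small rank. *)
Require Import Defs.
From HB Require Import structures.
From mathcomp Require Import all_boot all_order all_algebra.
From mathcomp Require Import boolp reals.
From mathcomp Require Import finmap.
From mathcomp.multinomials Require Import monalg.
From mathcomp Require Import ring zify.

Set Implicit Arguments.
Unset Strict Implicit.
Unset Printing Implicit Defensive.

Import GRing.Theory Num.Theory Order.TTheory.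

Local Open Scope ring_scope.
Local Open Scope quotient_scope.

(** * Induction on non-commutative polynomials *)

Section FreeAlgebra.
Variables (F : fieldType) (d : nat).
Implicit Types p q : {freealg F[d]}.

Definition freegen (i : 'I_d) : {freealg F[d]} := << 1 *g fmu i >>.

Lemma freealg_ind (K : {freealg F[d]} -> Prop) :
    (forall c, K (malgC c)) -> (forall i, K (freegen i)) ->
    (forall p q, K p -> K q -> K (p + q)) ->
    (forall p q, K p -> K q -> K (p * q)) ->
  forall p, K p.
Proof.
move=> KC Kx KD KM p; rewrite [p]monalgE; elim/big_ind: _ => [|//|w _].
  by rewrite -malgC0E.
have UM c1 c2 (w1 w2 : {fmonom 'I_d}) :
    << c1 *g w1 >> * << c2 *g w2 >> = << c1 * c2 *g mmul w1 w2 >>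
    :> {freealg F[d]} by apply: fgmulUU.
move: (p@_w) => c; rewrite -[c]mulr1 -[w]mul1m -UM; apply: (KM) => //.
case: w => w; elim: w => [|i w IHw].
  have -> // : FMonom [::] = mone :> {fmonom 'I_d}.
  by apply: val_inj; rewrite /= fm1.
have -> : FMonom (i :: w) = mmul (fmu i) (FMonom w).
  by apply: val_inj; rewrite /= fmM fmU.
by rewrite -[1]mulr1 -UM; apply: (KM) => //; apply: (Kx).
Qed.

End FreeAlgebra.

(** * Evaluation at matrix tuples and rank bounds on the ideal *)

Section Evaluation.
Variables (F : fieldType) (d : nat).
Implicit Types p q : {freealg F[d]}.

Lemma mxevalC n (A : 'I_d -> 'M[F]_n.+1) c : mxeval A (malgC c) = c%:M.
Proof. by rewrite /mxeval mmapU fm1 big_nil mulr1. Qed.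

Lemma mxeval_gen n (A : 'I_d -> 'M[F]_n.+1) i : mxeval A (freegen F i) = A i.
Proof. by rewrite /mxeval mmapU mul1r fmU big_seq1. Qed.

Lemma mxevalD n (A : 'I_d -> 'M[F]_n.+1) p q :
  mxeval A (p + q) = mxeval A p + mxeval A q.
Proof. exact: mmapD. Qed.

Lemma mxevalB n (A : 'I_d -> 'M[F]_n.+1) p q :
  mxeval A (p - q) = mxeval A p - mxeval A q.
Proof. exact: mmapB. Qed.

Lemma mxevalM n (A : 'I_d -> 'M[F]_n.+1) p q :
  mxeval A (p * q) = mxeval A p * mxeval A q.
Proof.
rewrite /mxeval malgME raddf_sum mulr_suml; apply: eq_bigr => v _.
rewrite raddf_sum mulr_sumr; apply: eq_bigr => w _ /=.
rewrite mmapU fmM big_cat /= -!mulmxE !mul_scalar_mx -!scalemxAl -!scalemxAr.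
by rewrite scalerA.
Qed.

(** [X] may be rectangular, so this covers cutting out a block and passing to a quotient of the
    underlying space. *)
Lemma mxeval_intertwine m n (A : 'I_d -> 'M[F]_m.+1) (B : 'I_d -> 'M[F]_n.+1)
    (X : 'M[F]_(n.+1, m.+1)) :
    (forall i, X *m A i = B i *m X) ->
  forall p, X *m mxeval A p = mxeval B p *m X.
Proof.
move=> XAB; elim/freealg_ind => [c|i|p q IHp IHq|p q IHp IHq].
- by rewrite !mxevalC scalar_mxC.
- by rewrite !mxeval_gen.
- by rewrite !mxevalD mulmxDr mulmxDl IHp IHq.
- by rewrite !mxevalM -!mulmxE mulmxA IHp -mulmxA IHq mulmxA.
Qed.

(** The scalar [c] is the constant term of [p]. *)
Lemma mxeval_zero p :
  exists c, forall n, mxeval (fun=> 0 : 'M[F]_n.+1) p = c%:M.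
Proof.
elim/freealg_ind: p => [c|i|p q [a pa] [b qb]|p q [a pa] [b qb]].
- by exists c => n; rewrite mxevalC.
- by exists 0 => n; rewrite mxeval_gen raddf0.
- by exists (a + b) => n; rewrite mxevalD pa qb raddfD.
- by exists (a * b) => n; rewrite mxevalM pa qb rmorphM.
Qed.

(** [C] is read off a derivation of membership: sums add the constants and multiplication never
    raises the rank. It depends neither on the size nor on the tuple. *)
Lemma mxrank_in_ideal r (P : 'I_r -> {freealg F[d]}) p : in_ideal P p ->
  exists C, forall n (A : 'I_d -> 'M[F]_n.+1) k,
    (forall i, \rank (mxeval A (P i)) <= k)%N ->
    (\rank (mxeval A p) <= C * k)%N.
Proof.
elim=> [i||q q' _ [C HC] _ [C' HC']|q q' _ [C HC]|q q' _ [C HC]].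
- by exists 1%N => n A k Pk; rewrite mul1n.
- by exists 0%N => n A k _; rewrite /mxeval mmap0 mxrank0.
- exists (C + C')%N => n A k Pk; rewrite mxevalD mulnDl.
  by apply: leq_trans (mxrank_add _ _) _; apply: leq_add; [apply: HC|apply: HC'].
- exists C => n A k Pk; rewrite mxevalM.
  by apply: leq_trans (mxrankM_maxr _ _) _; apply: HC.
- exists C => n A k Pk; rewrite mxevalM.
  by apply: leq_trans (mxrankM_maxl _ _) _; apply: HC.
Qed.

End Evaluation.

(** * The rank distance between matrices of different sizes *)

Section Padding.
Variable F : fieldType.

Lemma hatmx_out n (A : 'M[F]_n) i j :
  (n <= i)%N || (n <= j)%N -> hatmx A i j = 0.
Proof.
rewrite /hatmx; case: insubP => // i' lti _; case: insubP => // j' ltj _.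
by rewrite leqNgt lti leqNgt ltj.
Qed.

(** For [n <= N] padding respects sums and products but not 1, so only constants feel a change of
    size. *)
Definition padmx N n (A : 'M[F]_n) : 'M[F]_N := corner N (hatmx A).

Lemma padmx_block n m (A : 'M[F]_n) : padmx (n + m) A = block_mx A 0 0 0.
Proof.
apply/matrixP => i j; rewrite !mxE /hatmx.
case: splitP => i' ei; rewrite !mxE; case: splitP => j' ej; rewrite ?mxE /=.
- by rewrite ei ej !valK.
- by rewrite ei ej valK insubF // ltnNge leq_addr.
- by rewrite ei insubF // ltnNge leq_addr.
- by rewrite ei insubF // ltnNge leq_addr.
Qed.

Lemma padmx_id n (A : 'M[F]_n) : padmx n A = A.
Proof. by apply/matrixP => i j; rewrite !mxE /hatmx !valK. Qed.

Lemma padmxD N n (A B : 'M[F]_n) : (n <= N)%N ->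
  padmx N (A + B) = padmx N A + padmx N B.
Proof.
by move=> /subnKC <-; rewrite !padmx_block add_block_mx !addr0.
Qed.

Lemma padmxM N n (A B : 'M[F]_n) : (n <= N)%N ->
  padmx N (A *m B) = padmx N A *m padmx N B.
Proof.
by move=> /subnKC <-; rewrite !padmx_block mulmx_block !(mulmx0, mul0mx, addr0).
Qed.

Lemma rank_hatB_pad N n m (A : 'M[F]_n) (B : 'M[F]_m) :
    (n <= N)%N -> (m <= N)%N ->
  rank_hatB A B = \rank (padmx N A - padmx N B).
Proof.
move=> nN mN; rewrite /rank_hatB -(@rank_corner _ _ N); first 2 last.
- by rewrite geq_max nN.
- by congr mxrank; apply/matrixP => i j; rewrite !mxE.
move=> i j; apply: contraR; rewrite negb_and -!leqNgt !geq_max.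
by case/orP => /andP[ni mi]; rewrite !hatmx_out ?ni ?mi ?orbT ?subrr.
Qed.

Lemma rank_hatB_same n (A B : 'M[F]_n) : rank_hatB A B = \rank (A - B).
Proof. by rewrite (@rank_hatB_pad n) // !padmx_id. Qed.

Lemma rank_hatBC n m (A : 'M[F]_n) (B : 'M[F]_m) :
  rank_hatB A B = rank_hatB B A.
Proof.
rewrite !(@rank_hatB_pad (maxn n m)) ?leq_maxl ?leq_maxr //.
by rewrite -mxrank_opp opprB.
Qed.

Lemma rank_hatB_trans n m l (A : 'M[F]_n) (B : 'M[F]_m) (C : 'M[F]_l) :
  (rank_hatB A C <= rank_hatB A B + rank_hatB B C)%N.
Proof.
have [nN mN lN] : [/\ n <= n + m + l, m <= n + m + l & l <= n + m + l]%N.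
  by rewrite -addnA leq_addr addnCA leq_addr addnA leq_addl.
rewrite !(@rank_hatB_pad (n + m + l)) //.
by apply: leq_trans (mxrank_add _ _); rewrite addrA subrK.
Qed.

Lemma rank_hatBD n m (A A' : 'M[F]_n) (B B' : 'M[F]_m) :
  (rank_hatB (A + A') (B + B') <= rank_hatB A B + rank_hatB A' B')%N.
Proof.
rewrite !(@rank_hatB_pad (maxn n m)) ?leq_maxl ?leq_maxr //.
rewrite !padmxD ?leq_maxl ?leq_maxr //.
by apply: leq_trans (mxrank_add _ _); rewrite opprD addrACA.
Qed.

Lemma rank_hatBM n m (A A' : 'M[F]_n) (B B' : 'M[F]_m) :
  (rank_hatB (A *m A') (B *m B') <= rank_hatB A B + rank_hatB A' B')%N.
Proof.
rewrite !(@rank_hatB_pad (maxn n m)) ?leq_maxl ?leq_maxr //.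
rewrite !padmxM ?leq_maxl ?leq_maxr //.
set a := padmx _ A; set a' := padmx _ A'; set b := padmx _ B.
set b' := padmx _ B'.
have -> : a *m a' - b *m b' = (a - b) *m a' + b *m (a' - b').
  by rewrite mulmxBl mulmxBr addrA subrK.
apply: leq_trans (mxrank_add _ _) _.
by apply: leq_add; [apply: mxrankM_maxl|apply: mxrankM_maxr].
Qed.

(** The padded matrices differ only on the extra coordinates; the two truncated differences add up
    to the distance between the sizes. *)
Lemma rank_hatB_scalar n m (c : F) :
  (rank_hatB (c%:M : 'M_n) (c%:M : 'M_m) <= (n - m) + (m - n))%N.
Proof.
wlog /subnKC <- : n m / (n <= m)%N => [H|].
  by case: (leqP n m) => [/H//|/ltnW /H]; rewrite rank_hatBC addnC.
move: (m - n)%N => l; rewrite (@rank_hatB_pad (n + l)) ?leq_addr //.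
rewrite padmx_id padmx_block scalar_mx_block opp_block_mx add_block_mx.
rewrite subrr !subr0 sub0r rank_diag_block_mx mxrank0 add0n.
by rewrite addKn (leq_trans (rank_leq_row _)) ?leq_addl.
Qed.

Lemma rank_hatB_mxeval d (p : {freealg F[d]}) :
  exists C, forall n m (A : 'I_d -> 'M[F]_n.+1) (B : 'I_d -> 'M[F]_m.+1) k,
    (forall i, rank_hatB (A i) (B i) <= k)%N -> ((n - m) + (m - n) <= k)%N ->
    (rank_hatB (mxeval A p) (mxeval B p) <= C * k)%N.
Proof.
elim/freealg_ind: p => [c|i|p q [C HC] [C' HC']|p q [C HC] [C' HC']].
- exists 1%N => n m A B k _ nm; rewrite !mxevalC mul1n.
  by apply: leq_trans (rank_hatB_scalar _ _ _) _; rewrite !subSS.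
- by exists 1%N => n m A B k AB _; rewrite !mxeval_gen mul1n.
- exists (C + C')%N => n m A B k AB nm; rewrite !mxevalD mulnDl.
  by apply: leq_trans (rank_hatBD _ _ _ _) _; rewrite leq_add ?HC ?HC'.
- exists (C + C')%N => n m A B k AB nm; rewrite !mxevalM mulnDl.
  by apply: leq_trans (rank_hatBM _ _ _ _) _; rewrite leq_add ?HC ?HC'.
Qed.

End Padding.

(** * Replacing an exact solution by one of nearly the right size *)

Section SizeCorrection.
Variable F : fieldType.

(* [v *m u] is a projection of rank at most [d * k] whose column space contains
   that of every [M i]. *)
Lemma common_left_factor d m p k (M : 'I_d -> 'M[F]_(m, p)) :
    (forall i, \rank (M i) <= k)%N ->
  exists l (u : 'M[F]_(l, m)) (v : 'M[F]_(m, l)),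
    [/\ (l <= d * k)%N, u *m v = 1%:M & forall i, v *m (u *m M i) = M i].
Proof.
(* Column spaces are summed as row spaces of transposes; a basis of the sum has full column rank,
   hence a left inverse [u]. *)
move=> rM; pose S : 'M_m := (\sum_i <<(M i)^T>>)%MS; pose T := S^T.
have [u uv] : exists u, u *m col_base T = 1%:M.
  by apply/row_fullP/col_base_full.
exists (\rank T), u, (col_base T); split=> // [|i].
  rewrite mxrank_tr; apply: leq_trans (mxrank_sum_leqif _) _ => /=.
  apply: (@leq_trans (\sum_(i < d) k)); last by rewrite sum_nat_const card_ord.
  by apply: leq_sum => i _; rewrite mxrank_gen mxrank_tr.
have /submxP[X MX] : ((M i)^T <= S)%MS by rewrite (sumsmx_sup i) ?genmxE.
have -> : M i = T *m X^T by rewrite -trmx_mul -MX trmxK.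
rewrite !mulmxA; congr (_ *m _); rewrite -mulmxA.
by rewrite -[X in u *m X](mulmx_base T) (mulmxA u) uv mul1mx mulmx_base.
Qed.

Variables (d r : nat) (P : 'I_r -> {freealg F[d]}).

(** On row vectors, the kernel of [V] below is killed by every [B i], because [B i = V U (B i)].
    Thus [V] is a quotient map, and [C i] is the action induced by [B i] on the quotient. *)
Lemma shrink_solution n m (A : 'I_d -> 'M[F]_n.+1)
    (B : 'I_d -> 'M[F]_((n + m).+1)) k :
    (forall i, mxeval B (P i) = 0) ->
    (forall i, rank_hatB (A i) (B i) <= k)%N ->
  exists l (C : 'I_d -> 'M[F]_((n + l).+1)),
    [/\ (l <= d * k)%N, forall i, mxeval C (P i) = 0
      & forall i, (rank_hatB (A i) (C i) <= k)%N].
Proof.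
move=> PB AB; pose B' i : 'M_(n.+1 + m, n.+1 + m) := B i.
have AB' i : rank_hatB (A i) (B i) = \rank (block_mx (A i) 0 0 0 - B' i).
  by rewrite (@rank_hatB_pad _ (n.+1 + m)) ?leq_addr // padmx_block padmx_id.
(* The padded [A i] vanishes on the lower rows, so there the difference is [B i] up to sign. *)
have rM i : (\rank (dsubmx (B' i)) <= k)%N.
  rewrite -mxrank_opp; apply: leq_trans (AB i); rewrite AB'.
  have -> : - dsubmx (B' i) =
      row_mx 0 1%:M *m (block_mx (A i) 0 0 0 - B' i).
    rewrite mulmxBr mul_row_block !mul0mx !mulmx0 !addr0 row_mx0 sub0r.
    by rewrite -[in RHS](vsubmxK (B' i)) mul_row_col mul0mx add0r mul1mx.
  exact: mxrankM_maxr.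
have [l [u [v [ldk uv vuM]]]] := common_left_factor rM.
pose U : 'M_(n.+1 + l, n.+1 + m) := block_mx 1%:M 0 0 u.
pose V : 'M_(n.+1 + m, n.+1 + l) := block_mx 1%:M 0 0 v.
have UV : U *m V = 1%:M.
  by rewrite mulmx_block !(mulmx0, mul0mx, addr0, add0r) mul1mx uv
     -scalar_mx_block.
have VUB i : V *m (U *m B' i) = B' i.
  rewrite -[B' i]vsubmxK !mul_block_col !(mul0mx, addr0, add0r, mul1mx).
  by rewrite vuM.
pose C i : 'M_(n.+1 + l) := U *m B' i *m V.
exists l, C; split=> // [i|i].
  have /(_ (P i)) VC : forall p, V *m mxeval (C : 'I_d -> 'M_((n + l).+1)) p =
      mxeval B p *m V.
    by apply: mxeval_intertwine => j; rewrite /C !mulmxA -(mulmxA V) VUB.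
  by rewrite -[LHS]mul1mx -[1%:M]UV -mulmxA VC PB mul0mx mulmx0.
apply: leq_trans (AB i); rewrite AB'.
rewrite (@rank_hatB_pad _ (n.+1 + l)) ?leq_addr // padmx_block padmx_id.
(* [U] and [V] are the identity on the first [n.+1] coordinates, so they compress the padded [A i]
   to itself. *)
have -> : block_mx (A i) 0 0 0 - C i =
    U *m (block_mx (A i) 0 0 0 - B' i) *m V.
  rewrite mulmxBr mulmxBl !mulmx_block.
  by rewrite !(mulmx0, mul0mx, addr0, add0r) mul1mx mulmx1.
by apply: leq_trans (mxrankM_maxl _ _) _; apply: mxrankM_maxr.
Qed.

(** The gap is written [m.+1] because evaluation requires nonempty matrices, and the zero tuple on
    the extra coordinates is evaluated too. *)
Lemma grow_solution n m (A : 'I_d -> 'M[F]_((n + m.+1).+1))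
    (B : 'I_d -> 'M[F]_n.+1) k l :
    (forall i, mxeval B (P i) = 0) ->
    (forall i, rank_hatB (A i) (B i) <= k)%N ->
    (forall i, \rank (mxeval A (P i)) <= l)%N ->
  (m.+1 <= d * k + l)%N \/
  exists C : 'I_d -> 'M[F]_((n + m.+1).+1),
    (forall i, mxeval C (P i) = 0) /\
    (forall i, rank_hatB (A i) (C i) <= k)%N.
Proof.
move=> PB AB PA; pose A' i : 'M_(n.+1 + m.+1, n.+1 + m.+1) := A i.
have AB' i : rank_hatB (A i) (B i) = \rank (A' i - block_mx (B i) 0 0 0).
  by rewrite (@rank_hatB_pad _ (n.+1 + m.+1)) ?leq_addr // padmx_block padmx_id.
have [/forallP P0|] :=
  boolP [forall i, mxeval (fun=> 0 : 'M[F]_m.+1) (P i) == 0].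
  right; pose C i : 'M_(n.+1 + m.+1) := block_mx (B i) 0 0 0; exists C.
  split=> i; last first.
    apply: leq_trans (AB i); rewrite AB'.
    by rewrite (@rank_hatB_pad _ (n.+1 + m.+1)) // !padmx_id.
  (* The upper rows of [P i] at the padded tuple come from [P i] at [B], the lower ones from [P i]
     at the zero tuple; both vanish. *)
  have XC (X : 'M_(n.+1, n.+1 + m.+1)) : X = row_mx 1%:M 0 ->
      X *m mxeval (C : 'I_d -> 'M_((n + m.+1).+1)) (P i) = 0.
    move=> eX; rewrite -(mul0mx _ X) -(PB i); apply: mxeval_intertwine => j.
    have XCj : X *m C j = B j *m X.
      rewrite eX mul_row_block mul_mx_row.
      by rewrite !(mulmx0, mul0mx, addr0, mul1mx, mulmx1).
    exact: XCj.
  have YC (Y : 'M_(m.+1, n.+1 + m.+1)) : Y = row_mx 0 1%:M ->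
      Y *m mxeval (C : 'I_d -> 'M_((n + m.+1).+1)) (P i) = 0.
    move=> eY; rewrite -(mul0mx _ Y) -(eqP (P0 i)).
    apply: mxeval_intertwine => j.
    have YCj : Y *m C j = 0 *m Y.
      by rewrite eY mul_row_block !(mulmx0, mul0mx, addr0) row_mx0.
    exact: YCj.
  pose Z : 'M_(n.+1 + m.+1) := mxeval (C : 'I_d -> 'M_((n + m.+1).+1)) (P i).
  change (Z = 0); rewrite -[Z]mul1mx scalar_mx_block /block_mx mul_col_mx.
  by rewrite [_ *m Z]XC // [_ *m Z]YC // col_mx0.
rewrite negb_forall => /existsP[i P0]; left.
have rM j : (\rank (dsubmx (A' j)) <= k)%N.
  apply: leq_trans (AB j); rewrite AB'.
  have -> : dsubmx (A' j) =
      row_mx 0 1%:M *m (A' j - block_mx (B j) 0 0 0).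
    rewrite mulmxBr mul_row_block !mul0mx !mulmx0 !addr0 row_mx0 subr0.
    by rewrite -[in RHS](vsubmxK (A' j)) mul_row_col mul0mx add0r mul1mx.
  exact: mxrankM_maxr.
have [h [u [v [hdk uv vuM]]]] := common_left_factor rM.
(* [w] is the projection complementary to [v *m u] and kills the lower rows of every [A j]. So [X]
   sends the [A j] to 0, and [X] times the value of [P i] at [A] is [c] times [X]. *)
pose w := 1%:M - v *m u; pose X : 'M_(m.+1, n.+1 + m.+1) := row_mx 0 w.
have XA : X *m mxeval A (P i) = mxeval (fun=> 0 : 'M[F]_m.+1) (P i) *m X.
  apply: mxeval_intertwine => j.
  have XAj : X *m A' j = 0 *m X.
    rewrite mul0mx -[A' j]vsubmxK mul_row_col mul0mx add0r.
    by rewrite mulmxBl mul1mx -mulmxA vuM subrr.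
  exact: XAj.
have [c cP] := mxeval_zero (P i); rewrite cP in P0 XA.
have c0 : c != 0 by apply: contraNneq P0 => ->; rewrite raddf0.
have rw : (\rank w <= l)%N.
  apply: leq_trans (PA i); apply: leq_trans (mxrankM_maxr X _).
  rewrite XA mul_scalar_mx mxrank_scale_nz //.
  have -> : w = X *m col_mx 0 1%:M by rewrite mul_row_col mulmx0 add0r mulmx1.
  exact: mxrankM_maxl.
(* The identity of size [m.+1] splits as [w] plus [v *m u], of ranks at most [l] and [d * k]. *)
rewrite -[m.+1 in leqLHS](mxrank1 F) -[1%:M](subrK (v *m u)) addnC.
apply: leq_trans (mxrank_add _ _) _; apply: leq_add => //.
apply: leq_trans hdk; apply: leq_trans (mxrankM_maxl _ _) _.
exact: rank_leq_col.
Qed.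

Lemma solution_size n n' (A : 'I_d -> 'M[F]_n.+1) (B : 'I_d -> 'M[F]_n'.+1) k l :
    (forall i, mxeval B (P i) = 0) ->
    (forall i, rank_hatB (A i) (B i) <= k)%N ->
    (forall i, \rank (mxeval A (P i)) <= l)%N ->
  exists m (C : 'I_d -> 'M[F]_m.+1),
    [/\ ((n - m) + (m - n) <= d * k + l)%N, forall i, mxeval C (P i) = 0
      & forall i, (rank_hatB (A i) (C i) <= k)%N].
Proof.
move=> PB AB PA; case: (leqP n n') => [/subnKC en|lt_n'n].
  move: (n' - n)%N en => m en; case: n' / en B PB AB => B PB AB.
  have [h [C [hdk PC AC]]] := shrink_solution PB AB.
  exists (n + h)%N, C; split=> //.
  by rewrite addKn subnDA subnn sub0n add0n (leq_trans hdk) ?leq_addr.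
have en : (n' + (n - n').-1.+1 = n)%N.
  by rewrite prednK ?subn_gt0 // subnKC // ltnW.
move: (n - n').-1 en => m en.
case: n / en lt_n'n A AB PA => _ A AB PA.
have [le_m|[C [PC AC]]] := grow_solution PB AB PA.
  by exists n', B; split=> //; rewrite addKn subnDA subnn sub0n addn0.
by exists (n' + m.+1)%N, C; split=> //; rewrite subnn.
Qed.

End SizeCorrection.

(** * Maxima over finite index types *)

Lemma exists_uniform_bound (I : finType) (K : I -> nat -> Prop) :
    (forall i a b, (a <= b)%N -> K i a -> K i b) ->
    (forall i, exists C, K i C) ->
  exists C, forall i, K i C.
Proof.
move=> Kle /fin_all_exists[C KC]; exists (\max_i C i)%N => i.
by apply: Kle (KC i); apply: leq_bigmax.
Qed.

(** Positivity of [x] settles the empty index type, whose maximum is 0. *)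
Lemma bigmax_natr_lt (R : realType) (I : finType) (k : I -> nat) (x : R) :
  0 < x -> (forall i, (k i)%:R < x) -> (\max_i k i)%:R < x.
Proof.
move=> x0 kx; elim/big_ind: _ => // a b ax bx.
by case: (leqP a b).
Qed.

(** * Transfer of stability along an isomorphism *)

Section Presentations.
Variable F : fieldType.

Lemma fpalg_isom_inverse d r e s (P : 'I_r -> {freealg F[d]})
    (Q : 'I_s -> {freealg F[e]}) : fpalg_isom P Q ->
  exists (f : {linear fpalg P -> fpalg Q}) (g : {linear fpalg Q -> fpalg P}),
    [/\ monoid_morphism f, monoid_morphism g, cancel f g & cancel g f].
Proof.
case=> f [[f1 fM] [g fK gK]]; exists f.
pose gL := GRing.isLinear.Build F (fpalg Q) (fpalg P) *:%R g (can2_linear fK gK).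
exists (HB.pack g gL : {linear fpalg Q -> fpalg P}); split=> //.
split=> [|x y] /=; first by rewrite -f1 fK.
by apply: (can_inj fK); rewrite fM !gK.
Qed.

Lemma pi_quotalg_eq0 d r (P : 'I_r -> {freealg F[d]}) p :
  \pi_(quotalg P) p = 0 <-> in_ideal P p.
Proof.
have <- : \pi_(quotalg P) 0 = 0.
  apply: (@addrI _ (\pi_(quotalg P) 0)).
  by rewrite quotalg_addE !addr0.
by split=> [/eqP/quotalg_eqP|Ip]; rewrite ?subr0 //; apply/eqP/quotalg_eqP;
  rewrite subr0.
Qed.

(* The substitution of the [G i] for the generators is never constructed:
   [p'] stands for [p(G)], and only its values on matrices are needed. *)
Lemma lift_morphism d r e s (P : 'I_r -> {freealg F[d]})
    (Q : 'I_s -> {freealg F[e]}) (f : {linear fpalg P -> fpalg Q})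
    (G : 'I_d -> {freealg F[e]}) :
    monoid_morphism f ->
    (forall i, f (\pi_(quotalg P) (freegen F i)) = \pi_(quotalg Q) (G i)) ->
  forall p, exists2 p', f (\pi_(quotalg P) p) = \pi_(quotalg Q) p' &
    forall n (A : 'I_e -> 'M[F]_n.+1),
      mxeval A p' = mxeval (fun i => mxeval A (G i)) p.
Proof.
case=> f1 fM fG.
have pi1 : \pi_(quotalg P) 1 = 1 :> fpalg P by [].
have piQ1 : \pi_(quotalg Q) 1 = 1 :> fpalg Q by [].
elim/freealg_ind => [c|i|p q [p' fp pe] [q' fq qe]|p q [p' fp pe] [q' fq qe]].
- exists (malgC c) => [|n A]; last by rewrite !mxevalC.
  have malgC1 h : malgC c = c *: 1 :> {freealg F[h]}.
    by rewrite -mul_malgC mulr1.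
  rewrite !malgC1 -!quotalg_scaleE pi1 piQ1 -f1; exact: linearZ.
- by exists (G i) => // n A; rewrite mxeval_gen.
- exists (p' + q') => [|n A]; last by rewrite !mxevalD pe qe.
  by rewrite -!quotalg_addE -fp -fq; exact: raddfD.
- exists (p' * q') => [|n A]; last by rewrite !mxevalM pe qe.
  by rewrite -!quotalg_mulE -fp -fq; exact: fM.
Qed.

Lemma rank_stable_inverse (R : realType) d r e s (P : 'I_r -> {freealg F[d]})
    (Q : 'I_s -> {freealg F[e]}) (f : {linear fpalg P -> fpalg Q})
    (g : {linear fpalg Q -> fpalg P}) :
    monoid_morphism f -> monoid_morphism g -> cancel f g -> cancel g f ->
  rank_stable R P -> rank_stable R Q.
Proof.
move=> fM gM fK gK stabP.
pose G i := repr (f (\pi_(quotalg P) (freegen F i))).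
pose H j := repr (g (\pi_(quotalg Q) (freegen F j))).
have liftf := lift_morphism (G := G) fM (fun i => esym (reprK _)).
have liftg := lift_morphism (G := H) gM (fun j => esym (reprK _)).
have HQ n (B : 'I_d -> 'M[F]_n.+1) : (forall i, mxeval B (P i) = 0) ->
    forall k, mxeval (fun j => mxeval B (H j)) (Q k) = 0.
  move=> PB k; have [q qk <-] := liftg (Q k).
  have /mxrank_in_ideal[C rq] : in_ideal P q.
    apply/pi_quotalg_eq0; rewrite -qk -[RHS](raddf0 g); congr (g _).
    exact/pi_quotalg_eq0/in_ideal_gen.
  (* Exact vanishing is the rank bound with all ranks equal to 0. *)
  apply/eqP; rewrite -mxrank_eq0 -leqn0 -(muln0 C); apply: rq => i.
  by rewrite PB mxrank0.
have [C1 GP] : exists C, forall i n (A : 'I_e -> 'M[F]_n.+1) k,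
    (forall j, \rank (mxeval A (Q j)) <= k)%N ->
    (\rank (mxeval (fun i => mxeval A (G i)) (P i)) <= C * k)%N.
  apply: exists_uniform_bound => [i a b ab + n A k Qk|i].
    by move=> /(_ n A k Qk)/leq_trans; apply; rewrite leq_mul2r ab orbT.
  have [p pi pE] := liftf (P i).
  have /mxrank_in_ideal[C rp] : in_ideal Q p.
    apply/pi_quotalg_eq0; rewrite -pi -[RHS](raddf0 f); congr (f _).
    exact/pi_quotalg_eq0/in_ideal_gen.
  by exists C => n A k Qk; rewrite -pE; apply: rp.
have [C2 HG] : exists C, forall j n (A : 'I_e -> 'M[F]_n.+1) k,
    (forall l, \rank (mxeval A (Q l)) <= k)%N ->
    (rank_hatB (A j) (mxeval (fun i => mxeval A (G i)) (H j)) <= C * k)%N.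
  apply: exists_uniform_bound => [j a b ab + n A k Qk|j].
    by move=> /(_ n A k Qk)/leq_trans; apply; rewrite leq_mul2r ab orbT.
  have [p pj pE] := liftf (H j).
  have /mxrank_in_ideal[C rp] : in_ideal Q (freegen F j - p).
    by apply/quotalg_eqP; rewrite -pj reprK gK.
  exists C => n A k Qk; rewrite rank_hatB_same -pE -(mxeval_gen A) -mxevalB.
  exact: rp.
have [C3 HAB] : exists C, forall j n m
      (A : 'I_d -> 'M[F]_n.+1) (B : 'I_d -> 'M[F]_m.+1) k,
    (forall i, rank_hatB (A i) (B i) <= k)%N -> ((n - m) + (m - n) <= k)%N ->
    (rank_hatB (mxeval A (H j)) (mxeval B (H j)) <= C * k)%N.
  apply: exists_uniform_bound => [j a b ab + n m A B k AB nm|j].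
    by move=> /(_ n m A B k AB nm)/leq_trans; apply; rewrite leq_mul2r ab orbT.
  exact: rank_hatB_mxeval.
move=> eps eps0.
(* [K] dominates the coefficients of [q] and [k] in the final error; its summand [C1] serves the
   hypothesis of stability of [P], and the successor makes it positive. *)
pose K : R := (C2 + C3 * C1 + C3 * d.+1 + C1).+1%:R.
have K0 : 0 < K by rewrite ltr0n.
have eta0 : 0 < eps / K / 2 by rewrite !divr_gt0.
have [delta delta0 dP] := stabP _ eta0.
(* The first bound makes [G(A)] an almost solution of [P]; the second lets [q] use up at most half
   of [eps]. *)
exists (Num.min (delta / K) (eps / K / 2)) => [|n A QA].
  by rewrite lt_min eta0 divr_gt0.
pose q := (\max_k \rank (mxeval A (Q k)))%N.
have Qq k : (\rank (mxeval A (Q k)) <= q)%N by apply: leq_bigmax.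
have n0 : 0 < n.+1%:R :> R by rewrite ltr0n.
have : q%:R < Num.min (delta / K) (eps / K / 2) * n.+1%:R.
  apply: bigmax_natr_lt => [|k]; last by rewrite -ltr_pdivrMr //; apply: QA.
  by rewrite mulr_gt0 // lt_min eta0 divr_gt0.
have scaleK x : (q%:R < x / K * n.+1%:R) = (q%:R * K < x * n.+1%:R).
  by rewrite mulrAC ltr_pdivlMr.
rewrite -ltr_pdivrMr // lt_min !ltr_pdivrMr // scaleK => /andP[q_delta q_eps].
have [|n' [B [PB AB]]] := dP n (fun i => mxeval A (G i)).
  move=> i; rewrite /nrk ltr_pdivrMr //; apply: le_lt_trans q_delta.
  rewrite mulrC -natrM ler_nat; apply: leq_trans (GP i n A q Qq) _.
  by rewrite leq_mul2r ltnW ?orbT // ltnS leq_addl.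
pose k := (\max_i rank_hatB (mxeval A (G i)) (B i))%N.
have k_eps : k%:R < eps / K / 2 * n.+1%:R.
  by apply: bigmax_natr_lt => //; rewrite mulr_gt0.
have [m [C [nm PC AC]]] := solution_size PB
  (fun i => leq_bigmax i : (_ <= k)%N) (fun i => GP i n A q Qq).
exists m, (fun j => mxeval C (H j)); split=> [|j]; first exact: HQ.
(* [HAB] wants one bound for both the rank distance, at most [k], and the size gap, at most
   [d * k + C1 * q]; hence [d.+1 * k + C1 * q]. *)
have : (rank_hatB (A j) (mxeval C (H j)) <=
    C2 * q + C3 * (d.+1 * k + C1 * q))%N.
  apply: leq_trans
    (rank_hatB_trans _ (mxeval (fun i => mxeval A (G i)) (H j)) _) _.
  apply: leq_add; first exact: HG.
  apply: HAB => [i|].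
    by apply: leq_trans (AC i) _; rewrite mulSn -addnA leq_addr.
  by apply: leq_trans nm _; rewrite mulSn -addnA leq_addl.
rewrite -(ler_nat R) => /le_lt_trans; apply.
have -> : eps * n.+1%:R = K * (eps / K / 2 * n.+1%:R + eps / K / 2 * n.+1%:R).
  by rewrite -mulrDl -splitr mulrA mulrCA divff ?gt_eqF // mulr1.
apply: le_lt_trans (_ : K * (q%:R + k%:R) < _); last first.
  by rewrite ltr_pM2l // ltrD.
rewrite -natrD -natrM ler_nat.
have -> : (C2 * q + C3 * (d.+1 * k + C1 * q) =
    (C2 + C3 * C1) * q + C3 * d.+1 * k)%N by ring.
by rewrite mulnDr leq_add // leq_mul2r; apply/orP; right; lia.
Qed.

End Presentations.

Theorem theorem4p1 (R : realType) (F : fieldType) (d r e s : nat)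
    (P : 'I_r -> {freealg F[d]}) (Q : 'I_s -> {freealg F[e]}) :
  fpalg_isom P Q -> (rank_stable R P <-> rank_stable R Q).
Proof.
move=> /fpalg_isom_inverse[f [g [fM gM fK gK]]].
by split; [apply: rank_stable_inverse fM gM fK gK|
           apply: rank_stable_inverse gM fM gK fK].
Qed.
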